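(* Let $(\mathbf{C},I)$ be a $\sigma$-effectus. Then its scalars are commutative, i.e. $s\circ t=t\circ s$ for all morphisms $s,t\colon I\to I$ in $\mathbf{C}$.
   Context: Countable means finite (possibly empty) or countably infinite. A partial commutative monoid (PCM) is a set $X$ with $0\in X$ and a partial binary operation $\oplus$ with $(x\oplus y)\oplus z=x\oplus(y\oplus z)$, $x\oplus y=y\oplus x$, $0\oplus x=x$, where ''$=$'' is Kleene equality (if either side is defined, so is the other, and they are equal); $x\perp y$ means $x\oplus y$ is defined. An effect algebra is a PCM $E$ with an element $1\in E$ such that for each $a\in E$ there is a unique $a^{\perp}\in E$ with $a\oplus a^{\perp}=1$, and $a\perp 1$ implies $a=0$. A $\sigma$-PAM is a nonempty set $M$ with a partial operation $\bigoplus$ sending countable families $(x_j)_{j\in J}$ in $M$ to elements of $M$ (a family is summable if its sum is defined), such that: (partition-associativity) for each countable family $(x_j)_{j\in J}$ and countable partition $J=\biguplus_{k\in K}J_k$, the family is summable iff each $(x_j)_{j\in J_k}$ is summable and $(\bigoplus_{j\in J_k}x_j)_{k\in K}$ is summable, and then $\bigoplus_{j\in J}x_j=\bigoplus_{k\in K}\bigoplus_{j\in J_k}x_j$; (unary sum) one-element families are summable with sum their element; (limit) a countable family is summable whenever all its finite subfamilies are. A $\sigma$-PAM is a PCM with $x_1\oplus x_2=\bigoplus_{i\in\{1,2\}}x_i$ and $0=\bigoplus\emptyset$. A map between $\sigma$-PAMs is $\sigma$-additive if it sends summable families to summable families and preserves their sums; $\sigma$-biadditive means $\sigma$-additive in each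 argument. A $\sigma$-PAC is a category $\mathbf{C}$ with countable coproducts (coprojections $\kappa_i$), all of whose homsets are $\sigma$-PAMs with $\sigma$-biadditive composition (so there are zero morphisms $0_{AB}$), such that: (compatible sum) every compatible countable family $(f_j\colon A\to B)_{j\in J}$ is summable in $\mathbf{C}(A,B)$; (untying) if $f,g\colon A\to B$ are summable then so are $\kappa_1\circ f,\kappa_2\circ g\colon A\to B+B$. Here $(f_j\colon A\to B_j)_{j\in J}$ is compatible if there is $f\colon A\to\coprod_{j}B_j$ with $\triangleright_j\circ f=f_j$ for all $j$, where the partial projection $\triangleright_i\colon\coprod_jB_j\to B_i$ is determined by $\triangleright_i\circ\kappa_i=\mathrm{id}$ and $\triangleright_i\circ\kappa_k=0$ for $k\ne i$. A $\sigma$-effectus is a $\sigma$-PAC $\mathbf{C}$ with a distinguished object $I$ such that: (i) for each $A$, the PCM $\mathbf{C}(A,I)$ is an effect algebra, with top written $\mathbf{1}_A$; (ii) $\mathbf{1}_B\circ f=0_{AI}$ implies $f=0_{AB}$ for all $f\colon A\to B$; (iii) $\mathbf{1}_B\circ f\perp\mathbf{1}_B\circ g$ implies $f\perp g$ for all $f,g\colon A\to B$. Scalars are the morphisms $I\to I$, multiplied by composition. *)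

(* Defs.v *)
From mathcomp Require Import all_boot.
From Stdlib Require Import FunctionalExtensionality.

Set Implicit Arguments.
Unset Strict Implicit.
Unset Printing Implicit Defensive.

(* Partial operations are functions into an option type, so that Kleene       *)
(* equality is equality of options.  Countable index sets are countTypes; a   *)
(* countable partition of J indexed by K is a map p : J -> K with blocks      *)
(* p^-1(k), some of which may be empty.                                       *)

Record pcm := Pcm {
  pcm_sort :> Type;
  pcm0 : pcm_sort;
  pcm_add : pcm_sort -> pcm_sort -> option pcm_sort;
  pcm_addA : forall x y z,
    obind (fun u => pcm_add u z) (pcm_add x y) =
    obind (fun v => pcm_add x v) (pcm_add y z);
  pcm_addC : forall x y, pcm_add x y = pcm_add y x;
  pcm_add0 : forall x, pcm_add pcm0 x = Some x
}.

Definition pcm_perp (X : pcm) (x y : X) : Prop := isSome (pcm_add x y).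

Record is_effect_algebra (E : pcm) (one : E) : Prop := IsEffectAlgebra {
  orthocomplement_unique : forall a : E, exists! b : E, pcm_add a b = Some one;
  perp_one : forall a : E, pcm_perp a one -> a = pcm0 E
}.

Definition oget {T : Type} {o : option T} : isSome o -> T :=
  match o with
  | Some m => fun=> m
  | None => fun h => False_rect T (notF h)
  end.

Lemma ogetE (T : Type) (o : option T) (h : isSome o) : o = Some (oget h).
Proof. by case: o h. Qed.

Definition block {J K : countType} (p : J -> K) (k : K) {T : Type} (x : J -> T) :
  {j : J | p j == k} -> T := fun j => x (val j).

Definition finsub {J : countType} (F : seq J) {T : Type} (x : J -> T) :
  {j : J | j \in F} -> T := fun j => x (val j).

Arguments block {J K} p k {T} x.
Arguments finsub {J} F {T} x.

(* In psum_partition the family y of block sums is unique if it exists, so    *)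
(* the axiom says that x is summable iff all blocks and then the block sums   *)
(* are, and that the two sums then agree.                                     *)
Record sigmaPAM := SigmaPAM {
  pam_sort :> Type;
  psum : forall J : countType, (J -> pam_sort) -> option pam_sort;
  pam_nonempty : inhabited pam_sort;
  psum_partition : forall (J K : countType) (p : J -> K) (x : J -> pam_sort)
      (m : pam_sort),
    psum x = Some m <->
    exists y : K -> pam_sort,
      (forall k, psum (block p k x) = Some (y k)) /\ psum y = Some m;
  psum_unary : forall (J : countType) (j0 : J) (x : J -> pam_sort),
    (forall j, j = j0) -> psum x = Some (x j0);
  psum_limit : forall (J : countType) (x : J -> pam_sort),
    (forall F : seq J, isSome (psum (finsub F x))) -> isSome (psum x)
}.

Arguments psum {s J} x.

Definition summable (M : sigmaPAM) (J : countType) (x : J -> M) : Prop :=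
  isSome (psum x).

Definition pair_family {T : Type} (x y : T) : bool -> T :=
  fun b => if b then x else y.

Definition padd (M : sigmaPAM) (x y : M) : option M := psum (pair_family x y).

Definition perp (M : sigmaPAM) (x y : M) : Prop := summable (pair_family x y).

Definition empty_family (T : Type) : void -> T := fun j => match j with end.

Definition sigma_additive (M N : sigmaPAM) (h : M -> N) : Prop :=
  forall (J : countType) (x : J -> M) (m : M),
    psum x = Some m -> psum (fun j => h (x j)) = Some (h m).

Section SigmaPAMisPCM.
Variable M : sigmaPAM.

Lemma psum_reindex (J K : countType) (f : J -> K) (g : K -> J) (x : J -> M) :
  cancel f g -> cancel g f -> psum x = psum (fun k => x (g k)).
Proof.
move=> fK gK.
have blk k : psum (block f k x) = Some (x (g k)).
  have e : f (g k) == k by apply/eqP.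
  rewrite (@psum_unary M _ (exist (fun j => f j == k) (g k) e)) // => -[j jk].
  by apply/val_inj; rewrite /= -(eqP jk) fK.
have half m : psum x = Some m <-> psum (fun k => x (g k)) = Some m.
  apply: (iff_trans (psum_partition f x m)); split=> [[y [yP <-]]|xm].
    congr psum; apply/functional_extensionality => k.
    by have := yP k; rewrite blk => -[].
  by exists (fun k => x (g k)).
case E : (psum x) => [m|]; first by move/half: E.
by case E' : (psum _) => [m|] //; move/half: E'; rewrite E.
Qed.

Lemma psum_blockE (J K L : countType) (p : J -> K) (k : K) (x : J -> M)
    (f : L -> J) (g : J -> L) :
  (forall l, p (f l) = k) -> cancel f g -> (forall j, p j = k -> f (g j) = j) ->
  psum (block p k x) = psum (fun l => x (f l)).
Proof.
move=> pf fK gK.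
have pf' l : p (f l) == k by apply/eqP.
rewrite (@psum_reindex _ _ (fun j : {j | p j == k} => g (val j))
  (fun l => exist (fun j => p j == k) (f l) (pf' l))) //.
by case=> j jk; apply/val_inj => /=; rewrite gK //; apply/eqP.
Qed.

Lemma psum_block0 (J K : countType) (p : J -> K) (k : K) (x : J -> M) :
  (forall j, p j != k) -> psum (block p k x) = psum (@empty_family M).
Proof.
move=> pk.
pose f (j : {j | p j == k}) : void := False_rect void
  (elimN idP (pk (val j)) (valP j)).
rewrite (@psum_reindex _ _ f (fun v : void => match v with end)).
- by congr psum; apply/functional_extensionality; case.
- by case=> j jk; case: (elimN idP (pk j) jk).
- by case.
Qed.

Lemma summable_empty : summable (@empty_family M).
Proof.
have [m] := pam_nonempty M.
have := @psum_unary M unit tt (fun=> m) (fun j => match j with tt => erefl end).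
move/(psum_partition (fun=> false)) => [y [/(_ true) + _]].
by rewrite psum_block0 // /summable => ->.
Qed.

Definition pzero : M := oget summable_empty.

Lemma psum_empty : psum (@empty_family M) = Some pzero.
Proof. exact: ogetE. Qed.

Lemma psum_split (J : countType) (p : J -> bool) (x : J -> M) :
  psum x = obind (fun u => obind (fun v => padd u v) (psum (block p false x)))
                 (psum (block p true x)).
Proof.
have half m : psum x = Some m <->
    obind (fun u => obind (fun v => padd u v) (psum (block p false x)))
      (psum (block p true x)) = Some m.
  apply: (iff_trans (psum_partition p x m)); split=> [[y [yP ym]]|].
    rewrite !yP /= -ym; congr psum.
    by apply/functional_extensionality; case.
  case Et : (psum (block p true x)) => [u|] //=.
  case Ef : (psum (block p false x)) => [v|] //= uv.
  by exists (pair_family u v); split=> //; case.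
case E : (psum x) => [m|]; first by move/half: E.
by case E' : (obind _ _) => [m|] //; move/half: E'; rewrite E.
Qed.

Lemma paddC (x y : M) : padd x y = padd y x.
Proof.
rewrite /padd (@psum_reindex _ _ negb negb); try exact: negbK.
by congr psum; apply/functional_extensionality; case.
Qed.

Lemma padd0 (x : M) : padd pzero x = Some x.
Proof.
have unitP (j : unit) : j = tt by case: j.
have xE : psum (fun _ : unit => x) = Some x.
  by rewrite (@psum_unary _ _ tt _ unitP).
have blkE : psum (block (fun _ : unit => false) false (fun=> x)) = Some x.
  by rewrite (@psum_blockE _ _ unit _ _ _ id id).
have := psum_split (fun=> false) (fun _ : unit => x).
by rewrite xE blkE psum_block0 // psum_empty.
Qed.

Lemma paddA (x y z : M) :
  obind (fun u => padd u z) (padd x y) = obind (fun v => padd x v) (padd y z).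
Proof.
have unitP (j : unit) : j = tt by case: j.
pose w (j : option bool) := if j is Some b then pair_family x y b else z.
have bT1 : psum (block isSome true w) = padd x y.
  rewrite (@psum_blockE _ _ bool _ _ _ Some (odflt true)) => [|//|//|[]//].
  by congr psum; apply/functional_extensionality; case.
have bF1 : psum (block isSome false w) = Some z.
  rewrite (@psum_blockE _ _ unit _ _ _ (fun=> None) (fun=> tt)) => [|//|[]//|[]//].
  by rewrite (@psum_unary _ _ tt _ unitP).
pose q := pred1 (Some true).
have bT2 : psum (block q true w) = Some x.
  rewrite (@psum_blockE _ _ unit _ _ _ (fun=> Some true) (fun=> tt))
    => [|//|[]//|j /eqP->//].
  by rewrite (@psum_unary _ _ tt _ unitP).
have bF2 : psum (block q false w) = padd y z.
  rewrite (@psum_blockE _ _ bool _ _ _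
    (fun b => if b then Some false else None) isSome) => [|[]//|[]//|[[]|]//].
  by congr psum; apply/functional_extensionality; case.
have := psum_split isSome w; rewrite (psum_split q w) bT1 bF1 bT2 bF2 /=.
by move->.
Qed.

Definition pcm_of_sigmaPAM : pcm := Pcm paddA paddC padd0.

End SigmaPAMisPCM.

Arguments pzero {M}.

Record sigmaPAMCategory := SigmaPAMCategory {
  ob :> Type;
  hom : ob -> ob -> sigmaPAM;
  idm : forall A, hom A A;
  compose : forall A B D, hom B D -> hom A B -> hom A D;
  composeA : forall A B D E (h : hom D E) (g : hom B D) (f : hom A B),
    compose h (compose g f) = compose (compose h g) f;
  compose1m : forall A B (f : hom A B), compose (idm B) f = f;
  composem1 : forall A B (f : hom A B), compose f (idm A) = f;
  compose_additiver : forall A B D (g : hom B D),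
    sigma_additive (fun f : hom A B => compose g f);
  compose_additivel : forall A B D (f : hom A B),
    sigma_additive (fun g : hom B D => compose g f)
}.

Arguments hom {s} A B.
Arguments idm {s} A.
Arguments compose {s A B D} g f.

Declare Scope cat_scope.
Delimit Scope cat_scope with cat.
Notation "g \c f" := (compose g f) (at level 40, left associativity) : cat_scope.
Local Open Scope cat_scope.

Record countable_coproducts (C : sigmaPAMCategory) := CountableCoproducts {
  coprod : forall J : countType, (J -> C) -> C;
  coproj : forall (J : countType) (B : J -> C) (j : J), hom (B j) (coprod B);
  cotuple : forall (J : countType) (B : J -> C) (D : C),
    (forall j, hom (B j) D) -> hom (coprod B) D;
  cotupleK : forall (J : countType) (B : J -> C) (D : C)
      (f : forall j, hom (B j) D) (j : J),
    cotuple f \c coproj B j = f j;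
  cotuple_unique : forall (J : countType) (B : J -> C) (D : C)
      (f : forall j, hom (B j) D) (h : hom (coprod B) D),
    (forall j, h \c coproj B j = f j) -> h = cotuple f
}.

Section PartialProjections.
Variables (C : sigmaPAMCategory) (cp : countable_coproducts C).

Definition delta_hom (J : countType) (B : J -> C) (i k : J) : hom (B k) (B i) :=
  match @eqP _ k i with
  | ReflectT e => eq_rect k (fun l => hom (B k) (B l)) (idm (B k)) i e
  | ReflectF _ => pzero
  end.

Definition pproj (J : countType) (B : J -> C) (i : J) :
  hom (coprod cp B) (B i) := cotuple cp (delta_hom B i).

Lemma pproj_id (J : countType) (B : J -> C) (i : J) :
  pproj B i \c coproj cp B i = idm (B i).
Proof.
rewrite /pproj cotupleK /delta_hom; case: eqP => // e.
by rewrite (eq_axiomK e).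
Qed.

Lemma pproj_zero (J : countType) (B : J -> C) (i k : J) :
  k <> i -> pproj B i \c coproj cp B k = pzero.
Proof. by move=> ki; rewrite /pproj cotupleK /delta_hom; case: eqP. Qed.

Definition compatible (A : C) (J : countType) (B : J -> C)
    (f : forall j, hom A (B j)) : Prop :=
  exists g : hom A (coprod cp B), forall j, pproj B j \c g = f j.

End PartialProjections.

(* B + B is the coproduct over bool; the first coprojection is that of true.  *)
Record sigmaPAC := SigmaPAC {
  pac_cat :> sigmaPAMCategory;
  pac_coprod : countable_coproducts pac_cat;
  compatible_sum : forall (A B : pac_cat) (J : countType) (f : J -> hom A B),
    compatible pac_coprod (B := fun=> B) f -> summable f;
  untying : forall (A B : pac_cat) (f g : hom A B),
    perp f g ->
    perp (coproj pac_coprod (fun _ : bool => B) true \c f)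
         (coproj pac_coprod (fun _ : bool => B) false \c g)
}.

Record sigmaEffectus := SigmaEffectus {
  eff_pac :> sigmaPAC;
  eff_I : eff_pac;
  eff_one : forall A : eff_pac, hom A eff_I;
  eff_algebra : forall A : eff_pac,
    @is_effect_algebra (pcm_of_sigmaPAM (hom A eff_I)) (eff_one A);
  eff_zero : forall (A B : eff_pac) (f : hom A B),
    eff_one B \c f = pzero -> f = pzero;
  eff_perp : forall (A B : eff_pac) (f g : hom A B),
    perp (eff_one B \c f) (eff_one B \c g) -> perp f g
}.

(* Main.v *)
(* Since 1_I = id_I, the scalars form an effect monoid with countable sums.   *)
(* Its idempotents are central, and any two elements a, b are comparable up   *)
(* to a splitting of 1 into an idempotent p and its complement p': pb <= pa   *)
(* and p'a <= p'b.  Comparing st with ts, it suffices to show that d = 0      *)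
(* whenever ax + d = xa.  Comparing a with its complement a' = 1 - a, which   *)
(* has the opposite commutator with x, one can double pa and p'a', and with   *)
(* them the corresponding parts of d.  Iterating, all the multiples 2^n d     *)
(* exist, hence so does the sum of infinitely many copies of d, and d = 0.    *)
Require Import Defs.
From mathcomp Require Import all_boot.
From Stdlib Require Import FunctionalExtensionality IndefiniteDescription.

Set Implicit Arguments.
Unset Strict Implicit.
Unset Printing Implicit Defensive.

(** Two facts carry the argument. By [comparability], an inequality between two elements can be
    arranged on each half of a splitting by a central idempotent. By [archimedean], only zero lies
    below all terms of a summable sequence. The predicate [gap] records the defect [d] between the
    two products of [a] and [x]; [gap_iter_double] makes all its doublings exist, [iter_double_eq0]
    then forces [d] to vanish, and [sem_mulC] follows on each half. [eff_one_id] transfers this to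
    scalars. *)

(** * Binary and countable sums in a σ-PAM *)

Section OptionSum.
Variable M : sigmaPAM.

(** Lifting the sum to options makes associativity and commutativity unconditional equations;
    definedness of a sum becomes equality with some [Some z]. *)
Definition oadd (x y : option M) : option M :=
  obind (fun u => obind (fun v => padd u v) y) x.

Local Notation "x ⊕ y" := (oadd x y) (at level 50, left associativity).

Lemma oaddC x y : x ⊕ y = y ⊕ x.
Proof. by case: x y => [x|] [y|] //=; apply: paddC. Qed.

Lemma oaddA x y z : x ⊕ (y ⊕ z) = x ⊕ y ⊕ z.
Proof.
case: x y z => [x|] [y|] [z|] //=; last by rewrite /oadd; case: (padd x y).
by rewrite /oadd /=; have := paddA x y z => ->; case: (padd y z).
Qed.

Lemma oaddAC x y z : x ⊕ y ⊕ z = x ⊕ z ⊕ y.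
Proof. by rewrite -oaddA (oaddC y) oaddA. Qed.

Lemma oaddACA x y z t : x ⊕ y ⊕ (z ⊕ t) = x ⊕ z ⊕ (y ⊕ t).
Proof. by rewrite oaddA (oaddAC x) -oaddA. Qed.

Lemma oadd0 x : Some pzero ⊕ x = x.
Proof. by case: x => [x|] //=; apply: padd0. Qed.

Lemma oadd_Some x y z :
  x ⊕ y = Some z -> exists u v, x = Some u /\ y = Some v.
Proof. by case: x y => [u|] [v|] // _; exists u, v. Qed.

Definition ole (x y : M) : Prop := exists z, Some x ⊕ Some z = Some y.

Lemma psum_option (J : countType) (x : option J -> M) :
  psum x = Some (x None) ⊕ psum (fun j => x (Some j)).
Proof.
rewrite (psum_split (fun o : option J => ~~ isSome o) x).
pose toJ (o : {o : option J | ~~ isSome o == false}) : J :=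
  match o with
  | exist (Some j) _ => j
  | exist None h => False_rect J (notF h)
  end.
pose ofJ (j : J) : {o : option J | ~~ isSome o == false} :=
  exist (fun o => ~~ isSome o == false) (Some j) (eqxx false).
rewrite (@psum_reindex _ _ _ toJ ofJ) //; last first.
  by case=> -[j|] h //; apply/val_inj.
rewrite (@psum_unary _ _
  (exist (fun o => ~~ isSome o == true) None (eqxx true))) //.
by case=> -[j|] h //; apply/val_inj.
Qed.

Lemma psum_nat (x : nat -> M) :
  psum x = Some (x 0) ⊕ psum (fun n => x n.+1).
Proof.
rewrite (@psum_reindex _ _ _ (fun n => if n is m.+1 then Some m else None)
  (fun o => if o is Some m then m.+1 else 0)) ?psum_option //; by case.
Qed.

Lemma psum_ord (x : nat -> M) (s : nat -> M) n :
  s 0 = pzero -> (forall i, Some (s i) ⊕ Some (x i) = Some (s i.+1)) ->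
  psum (fun i : 'I_n => x i) = Some (s n).
Proof.
move=> s0 sS; elim: n => [|n IHn].
  rewrite s0 -psum_empty.
  rewrite (@psum_reindex _ _ _
    (fun i : 'I_0 => False_rect void (notF (ltn_ord i)))
    (fun v : void => match v with end)); try by case.
  by congr psum; apply/functional_extensionality; case.
rewrite (@psum_reindex _ _ _ (unlift (@ord_max n))
  (fun o => if o is Some i then lift ord_max i else ord_max)); first last.
- by case=> [i|]; rewrite ?liftK ?unlift_none.
- by move=> i; case: unliftP => [j|] ->.
rewrite psum_option oaddC -sS -IHn; congr (_ ⊕ _).
by congr psum; apply/functional_extensionality => i; rewrite lift_max.
Qed.

Lemma summable_block (J K : countType) (p : J -> K) (k : K) (x : J -> M) :
  summable x -> summable (block p k x).
Proof.
rewrite /summable; case E: (psum x) => [m|] // _.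
by have [y [yP _]] := (psum_partition p x m).1 E; rewrite yP.
Qed.

(** By the limit axiom only finite subfamilies matter, and each lies in an initial segment, whose
    sum is a term of [s]. *)
Lemma summable_partial_sums (x s : nat -> M) :
  s 0 = pzero -> (forall i, Some (s i) ⊕ Some (x i) = Some (s i.+1)) ->
  summable x.
Proof.
move=> s0 sS; apply: psum_limit => F.
pose N := (\max_(i <- F) i).+1.
have ltN j : j \in F -> j < N by move=> jF; rewrite ltnS; apply: leq_bigmax_seq.
have : summable (fun i : 'I_N => x i) by rewrite /summable (psum_ord _ s0 sS).
move/(@summable_block _ _ (fun i : 'I_N => val i \in F) true).
rewrite /summable (@psum_reindex _ _ {j | j \in F}
  (fun i => exist (fun j => j \in F) (val (val i))
     (elimT (@eqP _ (val (val i) \in F) true) (valP i)))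
  (fun j => exist (fun i : 'I_N => (val i \in F) == true)
     (Ordinal (ltN _ (valP j))) (introT eqP (valP j)))) //.
- by case=> i iF; apply/val_inj/val_inj.
- by case=> i iF; apply/val_inj.
Qed.

(** Both [y] and [z] are laid out on [nat * bool]: grouping by the first coordinate gives the sums
    [x n], so the whole family is summable, and [y] is one of its blocks. *)
Lemma summable_summand (x y z : nat -> M) :
  (forall n, Some (y n) ⊕ Some (z n) = Some (x n)) -> summable x -> summable y.
Proof.
move=> yz; rewrite /summable; case E: (psum x) => [m|] // _.
pose w (nb : nat * bool) := pair_family (y nb.1) (z nb.1) nb.2.
have : summable w.
  rewrite /summable ((psum_partition (fun nb : nat * bool => nb.1) w m).2 _) //.
  exists x; split=> // n; rewrite -yz.
  rewrite (@psum_blockE _ _ _ bool _ _ _ (fun b => (n, b)) snd) //.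
  by case=> i b /= ->.
move/(@summable_block _ _ (fun nb : nat * bool => nb.2) true).
rewrite /summable (@psum_blockE _ _ _ nat _ _ _ (fun n => (n, true)) fst) //.
by case=> i b /= ->.
Qed.

End OptionSum.

Notation "x ⊕ y" := (oadd x y) (at level 50, left associativity).

(** * Effect monoids with countable sums: cancellation, order, limits *)

Record sigmaEffectMonoid := SigmaEffectMonoid {
  sem_pam :> sigmaPAM;
  sem_one : sem_pam;
  sem_algebra : @is_effect_algebra (pcm_of_sigmaPAM sem_pam) sem_one;
  sem_mul : sem_pam -> sem_pam -> sem_pam;
  sem_mulA : forall x y z, sem_mul x (sem_mul y z) = sem_mul (sem_mul x y) z;
  sem_1mul : forall x, sem_mul sem_one x = x;
  sem_mul1 : forall x, sem_mul x sem_one = x;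
  sem_mulr : forall x, sigma_additive (fun y => sem_mul x y);
  sem_mull : forall y, sigma_additive (fun x => sem_mul x y)
}.

Section EffectMonoid.
Variable E : sigmaEffectMonoid.
Implicit Types (a b c d p x y z u v : E) (o : option E).

Local Notation one := (sem_one E).
Local Notation "x · y" := (sem_mul x y) (at level 40, left associativity).

Lemma compl_sig a : {b : E | Some a ⊕ Some b = Some one}.
Proof.
apply: constructive_indefinite_description.
by have [b [ab _]] := orthocomplement_unique (sem_algebra E) a; exists b.
Qed.

Definition compl a : E := sval (compl_sig a).

Lemma addK a : Some a ⊕ Some (compl a) = Some one.
Proof. exact: svalP (compl_sig a). Qed.

(** Cancellation: both summands are orthocomplements of x ⊕ z', where z' is the complement of [z],
    hence equal. *)
Lemma addI x o o' z : Some x ⊕ o = Some z -> Some x ⊕ o' = Some z -> o = o'.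
Proof.
move=> h h'; have [_ [u [_ ou]]] := oadd_Some h.
have [_ [v [_ ov]]] := oadd_Some h'; subst o o'.
have h1 w : Some x ⊕ Some w = Some z ->
    exists t, Some x ⊕ Some (compl z) = Some t /\ Some t ⊕ Some w = Some one.
  move=> xw; have e : Some x ⊕ Some (compl z) ⊕ Some w = Some one.
    by rewrite oaddAC xw addK.
  by have [t [_ [xt _]]] := oadd_Some e; exists t; rewrite -xt.
have [t [xt tu]] := h1 _ h; have [t' [xt' tv]] := h1 _ h'.
move: xt'; rewrite xt => -[tt']; subst t'.
have [r [_ rU]] := orthocomplement_unique (sem_algebra E) t.
by rewrite -(rU _ tu) -(rU _ tv).
Qed.

Lemma addI_Some x u v z :
  Some x ⊕ Some u = Some z -> Some x ⊕ Some v = Some z -> u = v.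
Proof. by move=> xu xv; case: (addI xu xv). Qed.

Lemma compl_unique a b : Some a ⊕ Some b = Some one -> b = compl a.
Proof. by move/addI_Some; apply; apply: addK. Qed.

Lemma complK a : compl (compl a) = a.
Proof. by apply/esym/compl_unique; rewrite oaddC addK. Qed.

(** Since 1 = 0 ⊕ 1 = x ⊕ y ⊕ 1, the element [x] is orthogonal to 1. *)
Lemma add_eq0 x y : Some x ⊕ Some y = Some pzero -> x = pzero.
Proof.
move=> xy; have := oadd0 (Some one); rewrite -xy oaddAC => h.
have [w [_ [xw _]]] := oadd_Some h.
by apply: (perp_one (sem_algebra E)); rewrite /pcm_perp [pcm_add _ _]xw.
Qed.

Lemma addx_eq0 x z : Some x ⊕ Some z = Some z -> x = pzero.
Proof.
by rewrite oaddC => xz; apply: (addI_Some xz); rewrite oaddC oadd0.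
Qed.

Lemma mulDr a x y z :
  Some x ⊕ Some y = Some z -> Some (a · x) ⊕ Some (a · y) = Some (a · z).
Proof.
move=> xy; have := sem_mulr a xy => <-; congr psum.
by apply/functional_extensionality; case.
Qed.

Lemma mulDl a x y z :
  Some x ⊕ Some y = Some z -> Some (x · a) ⊕ Some (y · a) = Some (z · a).
Proof.
move=> xy; have := sem_mull a xy => <-; congr psum.
by apply/functional_extensionality; case.
Qed.

Lemma mulr0 a : a · pzero = pzero.
Proof.
have := sem_mulr a (psum_empty E).
have -> : (fun j => a · empty_family E j) = @empty_family E.
  by apply/functional_extensionality; case.
by rewrite psum_empty => -[].
Qed.

Lemma mulCr a b : Some (a · b) ⊕ Some (a · compl b) = Some a.
Proof. by rewrite (mulDr _ (addK b)) sem_mul1. Qed.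

Lemma mulCl a b : Some (b · a) ⊕ Some (compl b · a) = Some a.
Proof. by rewrite (mulDl _ (addK b)) sem_1mul. Qed.

Lemma ole_mul x x' y y' : ole x x' -> ole y y' -> ole (x · y) (x' · y').
Proof.
move=> [u xu] [v yv].
have := mulDl y' xu; rewrite -(mulDr x yv) -oaddA => h.
by have [_ [t [_ tP]]] := oadd_Some h; exists t; rewrite -tP.
Qed.

Lemma ole0 x : ole x pzero -> x = pzero.
Proof. by case=> z; apply: add_eq0. Qed.

(* The remainder r plays the role of the infimum of the c n.                  *)
Lemma telescope (c x : nat -> E) :
  (forall n, Some (x n) ⊕ Some (c n.+1) = Some (c n)) ->
  exists s r, [/\ psum x = Some s, Some s ⊕ Some r = Some (c 0)
                & forall n, ole r (c n)].
Proof.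
(* Putting [T] in front of [x] makes the partial sum [s n.+1] the complement of [c n]. This shows
   that each further sum is defined, so the default [pzero] in [s] is never taken. *)
move=> xc; pose T := compl (c 0).
pose w n := if n is m.+1 then x m else T.
pose fix s n := if n is m.+1 then odflt pzero (padd (s m) (w m)) else pzero.
have s1 : s 1 = T by rewrite /= padd0.
have sc n : Some (s n.+1) ⊕ Some (x n) = Some (s n.+2) /\
            Some (s n.+1) ⊕ Some (c n) = Some one.
  elim: n => [|n [sx scn]].
    have sc0 : Some (s 1) ⊕ Some (c 0) = Some one by rewrite s1 oaddC addK.
    split=> //; move: (sc0); rewrite -xc oaddA => h.
    have [t [_ [tP _]]] := oadd_Some h.
    by rewrite [s 2]/= -/(s 1) -[padd _ _]/(Some _ ⊕ Some _) tP.
  have sc1 : Some (s n.+2) ⊕ Some (c n.+1) = Some one.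
    by rewrite -sx -oaddA xc.
  split=> //; move: (sc1); rewrite -xc oaddA => h.
  have [t [_ [tP _]]] := oadd_Some h.
  by rewrite [s n.+3]/= -/(s n.+2) -[padd _ _]/(Some _ ⊕ Some _) tP.
have : summable w.
  apply: (@summable_partial_sums _ w s) => // -[|n]; last by case: (sc n).
  by rewrite s1 oadd0.
rewrite /summable; case Ew: (psum w) => [m|] // _.
have h : Some T ⊕ psum x = Some m by rewrite -Ew (psum_nat w).
have [_ [S [_ xS]]] := oadd_Some h; rewrite xS in h.
have : Some T ⊕ (Some S ⊕ Some (compl m)) = Some one by rewrite oaddA h addK.
have : Some T ⊕ Some (c 0) = Some one by rewrite oaddC addK.
move=> /addI/[apply]; move/esym => Sr.
exists S, (compl m); split=> //.
(* The remainder [compl m] completes every tail of [x] to [c n], so it lies below each [c n]. *)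
have tails n : exists t, psum (fun i => x (i + n)) = Some t /\
    Some t ⊕ Some (compl m) = Some (c n).
  elim: n => [|n [t [xt tr]]].
    by exists S; split=> //; rewrite -xS; congr psum;
       apply/functional_extensionality => i; rewrite addn0.
  move: (xt); rewrite psum_nat => h'.
  have [_ [t' [_ xt']]] := oadd_Some h'; rewrite xt' add0n in h'.
  exists t'; split.
    rewrite -xt'; congr psum.
    by apply/functional_extensionality => i; rewrite addSnnS.
  by apply: (@addI (x n) _ _ (c n)); rewrite ?xc // oaddA h'.
by move=> n; have [t [_ tr]] := tails n; exists t; rewrite oaddC.
Qed.

(** The constant sequence [z] is summable too; splitting off its first term gives m = z ⊕ m for its
    sum m, and cancellation applies. *)
Lemma archimedean (x : nat -> E) z :
  summable x -> (forall n, ole z (x n)) -> z = pzero.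
Proof.
move=> xS zx.
have [y yP] : exists y : nat -> E, forall n, Some z ⊕ Some (y n) = Some (x n).
  pose y n := sval (constructive_indefinite_description _ (zx n)).
  by exists y => n; apply: svalP (constructive_indefinite_description _ (zx n)).
have := summable_summand yP xS; rewrite /summable.
case Ez: (psum _) => [m|] // _; move: (Ez); rewrite psum_nat Ez.
exact: addx_eq0.
Qed.

(** * Idempotents: centrality, ceilings, comparability *)

Lemma idem_mul_compl p : p · p = p -> p · compl p = pzero.
Proof.
by move=> pp; have := mulCr p p; rewrite pp oaddC; apply: addx_eq0.
Qed.

Lemma idem_compl_mul p : p · p = p -> compl p · p = pzero.
Proof.
by move=> pp; have := mulCl p p; rewrite pp oaddC; apply: addx_eq0.
Qed.

Lemma idem_compl p : p · p = p -> compl p · compl p = compl p.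
Proof.
move=> pp; have := mulCl (compl p) p.
by rewrite idem_mul_compl // oadd0 => -[].
Qed.

Lemma ole1 x : ole x one.
Proof. by exists (compl x); apply: addK. Qed.

Lemma ole_refl x : ole x x.
Proof. by exists pzero; rewrite oaddC oadd0. Qed.

(** With p' the complement of [p], monotonicity gives pap' ≤ pp' = 0 and p'ap ≤ p'p = 0, so pa = pap
    = ap. *)
Lemma idem_central p a : p · p = p -> p · a = a · p.
Proof.
move=> pp.
have le1 x y : ole (x · a · y) (x · one · y).
  by apply: ole_mul (ole_refl _); apply: ole_mul (ole_refl _) (ole1 _).
have pap' : p · a · compl p = pzero.
  by apply: ole0; have := le1 p (compl p); rewrite sem_mul1 idem_mul_compl.
have p'ap : compl p · a · p = pzero.
  by apply: ole0; have := le1 (compl p) p; rewrite sem_mul1 idem_compl_mul.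
have := mulCr (p · a) p; rewrite pap' oaddC oadd0 => -[<-].
have := mulCl (a · p) p; rewrite [compl p · _]sem_mulA p'ap oaddC oadd0 => -[<-].
by rewrite sem_mulA.
Qed.

(* The ceiling of b, obtained as the geometric series of the (1 - b)^n b.     *)
Lemma ceiling b :
  exists p, [/\ p · p = p, p · b = b & forall a, b · a = pzero -> p · a = pzero].
Proof.
pose c n := iter n (fun c => c · compl b) one.
pose x n := c n · b.
have xc n : Some (x n) ⊕ Some (c n.+1) = Some (c n) by apply: mulCr.
have b'c n : compl b · c n = c n.+1.
  by elim: n => [|n IHn]; rewrite /= ?sem_mul1 ?sem_1mul // sem_mulA IHn.
have [p [r [xp pr _]]] := telescope xc.
have p_annih a : b · a = pzero -> p · a = pzero.
  move=> ba; have := sem_mull pzero xp; rewrite mulr0.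
  have := sem_mull a xp.
  have -> : (fun n => x n · a) = fun n => x n · pzero.
    by apply/functional_extensionality => n; rewrite mulr0 -sem_mulA ba mulr0.
  by move=> -> [].
(* Multiplying the series by 1 - b shifts it by one term, so p = b ⊕ (1 - b)p; comparing with p = bp
   ⊕ (1 - b)p gives bp = b. *)
have bp : b · p = b.
  have b'p : psum (fun n => x n.+1) = Some (compl b · p).
    rewrite -(sem_mulr (compl b) xp); congr psum.
    by apply/functional_extensionality => n; rewrite /x sem_mulA b'c.
  move: xp; rewrite psum_nat b'p [x 0]sem_1mul oaddC => h.
  by move: (mulCl p b); rewrite oaddC => h'; apply: addI_Some h' h.
have pp : p · p = p.
  have bp' : b · compl p = pzero.
    by have := mulCr b p; rewrite bp oaddC; apply: addx_eq0.
  by have := mulCr p p; rewrite (p_annih _ bp') oaddC oadd0 => -[].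
by exists p; split=> //; rewrite idem_central.
Qed.

(* Removing the common part a_n b_n from a and b over and over again leaves   *)
(* remainders with product zero, which the ceiling of one of them separates.  *)
Lemma comparability a b :
  exists p, [/\ p · p = p, ole (p · b) (p · a) &
                ole (compl p · a) (compl p · b)].
Proof.
pose ab n := iter n (fun q => (q.1 · compl q.2, compl q.1 · q.2)) (a, b).
pose x n := (ab n).1 · (ab n).2.
have [S [ra [xS Sra ra_le]]] : exists s r, [/\ psum x = Some s,
    Some s ⊕ Some r = Some a & forall n, ole r (ab n).1].
  by apply: (@telescope (fun n => (ab n).1)) => n; apply: mulCr.
have [S' [rb [xS' Srb rb_le]]] : exists s r, [/\ psum x = Some s,
    Some s ⊕ Some r = Some b & forall n, ole r (ab n).2].
  by apply: (@telescope (fun n => (ab n).2)) => n; apply: mulCl.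
move: xS'; rewrite xS => -[SS']; subst S'.
(* The product of the remainders lies below every term a_n b_n of a summable sequence. *)
have rab : ra · rb = pzero.
  apply: (@archimedean x); first by rewrite /summable xS.
  by move=> n; apply: ole_mul.
have [p [pp pra prb]] := ceiling ra.
exists p; split=> //.
  have := mulDr p Srb; rewrite (prb _ rab) oaddC oadd0 => -[<-].
  by exists (p · ra); apply: mulDr.
have p'ra : compl p · ra = pzero.
  by have := mulCl ra p; rewrite pra oaddC; apply: addx_eq0.
have := mulDr (compl p) Sra; rewrite p'ra oaddC oadd0 => -[<-].
by exists (compl p · rb); apply: mulDr.
Qed.

(** * Commutators and their repeated doubling *)

Definition gap a x d : Prop :=
  Some (a · x) ⊕ Some d = Some (x · a) \/ Some (x · a) ⊕ Some d = Some (a · x).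

Lemma gap_idem p a x d : p · p = p -> gap a x d -> gap (p · a) x (p · d).
Proof.
move=> pp [] h; [left|right]; have := mulDr p h;
  by rewrite !sem_mulA (idem_central x pp).
Qed.

(** Both ax ⊕ a'x and xa ⊕ xa' equal x, so complementing [a] reverses the sign of the defect; the
    disjunction in [gap] absorbs this. *)
Lemma gap_compl a x d : gap a x d -> gap (compl a) x d.
Proof.
move=> [] h; [right|left].
  apply: (@addI (a · x) _ _ x); last exact: mulCl.
  by rewrite (oaddC (Some (x · _))) oaddA h mulCr.
apply: (@addI (x · a) _ _ x); last exact: mulCr.
by rewrite (oaddC (Some (_ · x))) oaddA h mulCl.
Qed.

Lemma gap_double a a2 x d : Some a ⊕ Some a = Some a2 -> gap a x d ->
  exists e, Some d ⊕ Some d = Some e /\ gap a2 x e.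
Proof.
move=> aa [] h; have := congr2 (@oadd E) h h;
  rewrite oaddACA (mulDl _ aa) (mulDr _ aa) => h2;
  have [_ [e [_ de]]] := oadd_Some h2; exists e; split=> //;
  by [left; rewrite -de | right; rewrite -de].
Qed.

Definition double o := o ⊕ o.

Lemma iter_double_add n o o' :
  iter n double (o ⊕ o') = iter n double o ⊕ iter n double o'.
Proof. by elim: n => //= n ->; rewrite /double oaddACA. Qed.

Lemma iter_double_mul n p d m :
  iter n double (Some d) = Some m -> iter n double (Some (p · d)) = Some (p · m).
Proof.
elim: n m => [m [->]//|n IHn m] /= h; move: (h) => /oadd_Some [u [_ [hu _]]].
by rewrite (IHn _ hu) /double; apply: mulDr; rewrite -h hu.
Qed.

(** Here pa ⊕ pa lies below pa ⊕ pa' = p. *)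
Lemma double_below_compl p a : ole (p · a) (p · compl a) ->
  exists a2, Some (p · a) ⊕ Some (p · a) = Some a2.
Proof.
move=> [z az]; have := mulCr p a; rewrite -az oaddA => h.
by have [t [_ [tP _]]] := oadd_Some h; exists t.
Qed.

Lemma mul_compl_add p x y :
  exists z, Some (p · x) ⊕ Some (compl p · y) = Some z.
Proof.
have := addK p; rewrite -(mulCr p x) -(mulCr (compl p) y) oaddACA => h.
by have [t [_ [tP _]]] := oadd_Some h; exists t.
Qed.

Lemma gap_iter_double n a x d :
  gap a x d -> exists m, iter n double (Some d) = Some m.
Proof.
elim: n a d => [|n IHn] a d ad; first by exists d.
have half p b : p · p = p -> gap b x d -> ole (p · b) (p · compl b) ->
    exists m, iter n.+1 double (Some (p · d)) = Some m.
  move=> pp bd /double_below_compl [b2 bb].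
  have [e [de b2e]] := gap_double bb (gap_idem pp bd).
  by have [m em] := IHn _ _ b2e; exists m; rewrite iterSr /double de.
have [p [pp le1 le2]] := comparability (compl a) a.
have [m1 dm1] := half p a pp ad le1.
have [m2 dm2] : exists m, iter n.+1 double (Some (compl p · d)) = Some m.
  by apply: (half _ (compl a) (idem_compl pp) (gap_compl ad)); rewrite complK.
have [z hz] := mul_compl_add p m1 m2; exists z.
(* The multiples of pd and p'd are glued: as [p] is idempotent, they are unchanged by multiplication
   with p and p' respectively, which makes them orthogonal. *)
rewrite -(mulCl d p) iter_double_add -hz.
rewrite -(iter_double_mul p dm1) -(iter_double_mul (compl p) dm2).
by rewrite !sem_mulA pp idem_compl.
Qed.

Lemma iter_double_eq0 d :
  (forall n, exists m, iter n double (Some d) = Some m) -> d = pzero.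
Proof.
move=> dbl; pose e n := odflt pzero (iter n double (Some d)).
have eE n : Some (e n) = iter n double (Some d).
  by rewrite /e; have [m ->] := dbl n.
have eS n : Some (e n) ⊕ Some (e n) = Some (e n.+1) by rewrite !eE.
have [s [r [es _ _]]] : exists s r, [/\ psum e = Some s,
    Some s ⊕ Some r = Some (compl (e 0)) & forall n, ole r (compl (e n))].
  (* The complements of the 2^n d decrease by exactly 2^n d at each step, so telescoping makes [e]
     itself summable. *)
  apply: (@telescope (fun n => compl (e n))) => n.
  apply: (@addI (e n) _ _ one); last exact: addK.
  by rewrite oaddA eS addK.
apply: (@archimedean e); first by rewrite /summable es.
elim=> [|n [z dz]]; first exact: ole_refl.
have := eS n; rewrite -[in X in X ⊕ _ = _]dz -oaddA => h.
by have [_ [t [_ tP]]] := oadd_Some h; exists t; rewrite -tP.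
Qed.

Lemma gap_eq0 a x d : gap a x d -> d = pzero.
Proof. by move=> ad; apply: iter_double_eq0 => n; apply: gap_iter_double ad. Qed.

Theorem sem_mulC a b : a · b = b · a.
Proof.
have half p x y : p · p = p -> ole (p · (x · y)) (p · (y · x)) ->
    p · (x · y) = p · (y · x).
  move=> pp [d xyd]; have xyE : gap (p · x) y d.
    by left; rewrite sem_mulA -(idem_central y pp) -!sem_mulA.
  by move: xyd; rewrite (gap_eq0 xyE) oaddC oadd0 => -[].
have [p [pp le1 le2]] := comparability (b · a) (a · b).
suff : Some (a · b) = Some (b · a) by case.
rewrite -(mulCl (a · b) p) (half _ _ _ pp le1).
by rewrite -(half _ _ _ (idem_compl pp) le2) mulCl.
Qed.

End EffectMonoid.

(** * The scalars of a σ-effectus *)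

Section Scalars.
Variable C : sigmaEffectus.
Local Notation I := (eff_I C).

(** Let e be the complement of the identity. Composing id ⊕ e = 1 with 1 on the left shows that 1
    and 1 ∘ e are orthogonal, so 1 ∘ e = 0 and e = 0. *)
Lemma eff_one_id : eff_one I = idm I.
Proof.
have [e [ide _]] := orthocomplement_unique (eff_algebra I) (idm I).
have e0 : e = pzero.
  apply: eff_zero; apply: (perp_one (eff_algebra I)).
  have := @compose_additiver _ I I I (eff_one I) _ _ _ ide.
  rewrite /pcm_perp [pcm_add _ _]paddC /= /padd.
  have -> : (fun j => compose (eff_one I) (pair_family (idm I) e j)) =
      pair_family (eff_one I) (compose (eff_one I) e).
    by apply/functional_extensionality; case=> //=; rewrite composem1.
  by move->.
by move: ide; rewrite e0 [pcm_add _ _]paddC padd0 => -[].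
Qed.

Definition scalar_monoid : sigmaEffectMonoid.
Proof.
refine (@SigmaEffectMonoid (hom I I) (idm I) _ (@compose C I I I) _ _ _ _ _).
- by rewrite -eff_one_id; apply: eff_algebra.
- by move=> x y z; apply: composeA.
- exact: compose1m.
- exact: composem1.
- exact: compose_additiver.
- exact: compose_additivel.
Defined.

End Scalars.

Theorem corollary42 (C : sigmaEffectus) (s t : hom (eff_I C) (eff_I C)) :
  compose s t = compose t s.
Proof. exact: (@sem_mulC (scalar_monoid C)). Qed.
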